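(* Let $p$ be an odd prime number and $m\ge 1$ an integer. With respect to the Haar measure, the probability that two randomly chosen monic polynomials of degrees $m$ and $2$ in $\mathbf{Z}_p[x]$ are relatively prime is equal to $1$; that is, $$\left(\mu^m_{\mathrm{Haar}}\times\mu^2_{\mathrm{Haar}}\right)\left(\{(f,g)\in P_m(\mathbf{Z}_p)\times P_2(\mathbf{Z}_p) : f\text{ and } g\text{ are relatively prime}\}\right)=1.$$
   Context: $\mathbf{Z}_p=\varprojlim \mathbf{Z}/p^k\mathbf{Z}$ is the ring of $p$-adic integers. For a commutative ring $R$, two polynomials $f,g\in R[x]$ are called relatively prime (or coprime) if there is no monic polynomial of positive degree in $R[x]$ that divides both $f$ and $g$. For $n\ge1$, $P_n(\mathbf{Z}_p)$ denotes the set of monic polynomials of degree $n$ over $\mathbf{Z}_p$, identified with $\mathbf{Z}_p^n$ by sending $x^n+a_{n-1}x^{n-1}+\cdots+a_0$ to $(a_0,\ldots,a_{n-1})$. $\mu_{\mathrm{Haar}}$ is the unique Haar measure on $\mathbf{Z}_p$ of total mass $1$, and $\mu^n_{\mathrm{Haar}}$ is the resulting product measure on $P_n(\mathbf{Z}_p)=\mathbf{Z}_p^n$. Pairs are measured by the product measure $\mu^m_{\mathrm{Haar}}\times\mu^2_{\mathrm{Haar}}$ on $P_m(\mathbf{Z}_p)\times P_2(\mathbf{Z}_p)$. *)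

(* Defs.v *)
From HB Require Import structures.
From mathcomp Require Import all_boot all_order all_algebra.
From mathcomp Require Import all_classical all_reals all_analysis.

Set Implicit Arguments.
Unset Strict Implicit.
Unset Printing Implicit Defensive.

Import Order.TTheory GRing.Theory Num.Theory.

Local Open Scope classical_set_scope.
Local Open Scope ring_scope.

Section Reduction.
Variables (p k : nat).

(* For p > 1 this is the canonical projection Z/p^(k+2) -> Z/p^(k+1).  The
   exponents start at 1 because 'Z_1 denotes Z/2, not the zero ring. *)
Definition padic_red (x : 'Z_(p ^ k.+2)) : 'Z_(p ^ k.+1) := inZp x.

Lemma Zp_trunc_dvd :
  ((Zp_trunc (p ^ k.+1)).+2 %| (Zp_trunc (p ^ k.+2)).+2)%N.
Proof.
have [p1|] := ltnP 1 p; last first.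
  by case: p => [|[|//]] _; rewrite ?exp1n// !exp0n.
rewrite !Zp_cast ?dvdn_exp2l //;
  by rewrite (leq_trans p1)// -[X in (X <= _)%N]expn1 leq_exp2l.
Qed.

Lemma padic_red_nat n : padic_red n%:R = n%:R.
Proof.
apply: val_inj; rewrite /padic_red /= !Zp_nat /= modn_dvdm//.
exact: Zp_trunc_dvd.
Qed.

Lemma padic_redD x y : padic_red (x + y) = padic_red x + padic_red y.
Proof. by rewrite -(natr_Zp x) -(natr_Zp y) -natrD !padic_red_nat natrD. Qed.

Lemma padic_redM x y : padic_red (x * y) = padic_red x * padic_red y.
Proof. by rewrite -(natr_Zp x) -(natr_Zp y) -natrM !padic_red_nat natrM. Qed.

Lemma padic_redN x : padic_red (- x) = - padic_red x.
Proof.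
by apply/eqP; rewrite -addr_eq0 -padic_redD addNr; apply/eqP/(padic_red_nat 0).
Qed.

End Reduction.

(* Elements of the inverse limit of the rings Z/p^k, k >= 1, as compatible
   families; [x k] is the residue of x modulo p^(k+1). *)
Record padic (p : nat) := Padic {
  residue :> forall k, 'Z_(p ^ k.+1);
  residue_compat : forall k, padic_red (residue k.+1) = residue k }.

Lemma padic_ext p (x y : padic p) : (forall k, x k = y k) -> x = y.
Proof.
case: x y => [x cx] [y cy] /= xy.
have {xy}E : x = y by exact: functional_extensionality_dep.
by case: _ / E cy => cy; congr Padic; exact: Prop_irrelevance.
Qed.

HB.instance Definition _ p := gen_eqMixin (padic p).
HB.instance Definition _ p := gen_choiceMixin (padic p).

Section PadicRing.
Variable p : nat.
Implicit Types x y z : padic p.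

Definition padic0 : padic p :=
  @Padic p (fun=> 0) (fun k => padic_red_nat p k 0).

Definition padic1 : padic p :=
  @Padic p (fun=> 1) (fun k => padic_red_nat p k 1).

Fact padic_opp_compat x k : padic_red (- x k.+1) = - x k.
Proof. by rewrite padic_redN residue_compat. Qed.
Definition padic_opp x : padic p := Padic (padic_opp_compat x).

Fact padic_add_compat x y k : padic_red (x k.+1 + y k.+1) = x k + y k.
Proof. by rewrite padic_redD !residue_compat. Qed.
Definition padic_add x y : padic p := Padic (padic_add_compat x y).

Fact padic_mul_compat x y k : padic_red (x k.+1 * y k.+1) = x k * y k.
Proof. by rewrite padic_redM !residue_compat. Qed.
Definition padic_mul x y : padic p := Padic (padic_mul_compat x y).

Fact padic_addA : associative padic_add.
Proof. by move=> x y z; apply: padic_ext => k; exact: addrA. Qed.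
Fact padic_addC : commutative padic_add.
Proof. by move=> x y; apply: padic_ext => k; exact: addrC. Qed.
Fact padic_add0 : left_id padic0 padic_add.
Proof. by move=> x; apply: padic_ext => k; exact: add0r. Qed.
Fact padic_addN : left_inverse padic0 padic_opp padic_add.
Proof. by move=> x; apply: padic_ext => k; exact: addNr. Qed.
Fact padic_mulA : associative padic_mul.
Proof. by move=> x y z; apply: padic_ext => k; exact: mulrA. Qed.
Fact padic_mulC : commutative padic_mul.
Proof. by move=> x y; apply: padic_ext => k; exact: mulrC. Qed.
Fact padic_mul1 : left_id padic1 padic_mul.
Proof. by move=> x; apply: padic_ext => k; exact: mul1r. Qed.
Fact padic_mulDl : left_distributive padic_mul padic_add.
Proof. by move=> x y z; apply: padic_ext => k; exact: mulrDl. Qed.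
Fact padic_1_neq0 : padic1 != padic0.
Proof.
by apply/eqP => /(congr1 (fun x : padic p => x 0%N)) /eqP; rewrite oner_eq0.
Qed.

HB.instance Definition _ :=
  GRing.isZmodule.Build (padic p) padic_addA padic_addC padic_add0 padic_addN.
HB.instance Definition _ := GRing.Zmodule_isComNzRing.Build (padic p)
  padic_mulA padic_mulC padic_mul1 padic_mulDl padic_1_neq0.

HB.instance Definition _ := isPointed.Build (padic p) 0.

(* The inverse limit topology: the initial topology of the inclusion into the
   product of the discrete rings Z/p^(k+1). *)
Definition padic_incl (x : padic p) :
  prod_topology (fun k => discrete_topology 'Z_(p ^ k.+1)) := x.

HB.instance Definition _ :=
  Topological.copy (padic p) (initial_topology padic_incl).

HB.instance Definition _ :=
  Measurable.copy (padic p) (g_sigma_algebraType (@open (padic p))).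

End PadicRing.

(* A Haar measure of total mass 1 on Z_p: a translation invariant Borel
   probability (regularity is automatic, Z_p being compact and metrizable). *)
Definition is_padic_haar (R : realType) (p : nat)
    (mu : probability (padic p) R) : Prop :=
  forall (a : padic p) (A : set (padic p)), measurable A ->
    mu ((fun x => a + x) @` A) = mu A.

Section TupleProbability.
Context d (T : measurableType d) (R : realType).

Definition tuple_cons n (x : T * n.-tuple T) : n.+1.-tuple T :=
  [tuple of x.1 :: x.2].

Fact measurable_tuple_cons n : measurable_fun setT (@tuple_cons n).
Proof. exact: measurable_cons. Qed.

HB.instance Definition _ n :=
  isMeasurableFun.Build _ _ _ _ (@tuple_cons n) (@measurable_tuple_cons n).

(* The n-fold product measure, transported along T * T^n = T^(n+1). *)
Fixpoint tuple_prob (P : probability T R) (n : nat) :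
    probability (n.-tuple T) R :=
  match n with
  | 0 => \d_([tuple] : 0.-tuple T)
  | n'.+1 => distribution (P \x tuple_prob P n')%E (@tuple_cons n')
  end.

Lemma measurable_box n (A : 'I_n -> set T) : (forall i, measurable (A i)) ->
  measurable [set t : n.-tuple T | forall i, A i (tnth t i)].
Proof.
move=> mA; rewrite (_ : [set t | _] =
    \bigcap_(i in [set: 'I_n]) ((fun t : n.-tuple T => tnth t i) @^-1` A i)).
  apply: fin_bigcap_measurable => [|i _]; first exact: finite_finset.
  by have := measurable_tnth i measurableT (mA i); rewrite setTI.
by apply/seteqP; split=> t /= tA i; [move=> _|]; exact: tA.
Qed.

Lemma tuple_prob_box (P : probability T R) n (A : 'I_n -> set T) :
  (forall i, measurable (A i)) ->
  tuple_prob P n [set t | forall i, A i (tnth t i)] =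
  (\prod_(i < n) P (A i))%E.
Proof.
elim: n A => [|n IHn] A mA.
  rewrite big_ord0 /= diracE (_ : _ \in _)//.
  by rewrite inE /= => -[].
rewrite big_ord_recl -IHn//.
have mB :
    measurable [set t : n.-tuple T | forall i, A (lift ord0 i) (tnth t i)].
  exact: (@measurable_box n (fun i => A (lift ord0 i))).
rewrite -product_measure1E//=.
congr ((P \x tuple_prob P n)%E _).
apply/seteqP; split=> [[x t]|[x t]] /=.
  move=> xtA; split=> [|i]; first by have := xtA ord0; rewrite tnth0.
  by have := xtA (lift ord0 i); rewrite tnthS.
by move=> [xA tA] i; case: (unliftP ord0 i) => [j|] ->; rewrite ?tnth0 ?tnthS.
Qed.

End TupleProbability.

(* The monic polynomial X^n + a_(n-1) X^(n-1) + ... + a_0; by the next lemmas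
   this identifies n-tuples with monic polynomials of degree n. *)
Definition monic_of (R : nzRingType) n (a : n.-tuple R) : {poly R} :=
  'X^n + \poly_(i < n) a`_i.

Lemma size_monic_of (R : nzRingType) n (a : n.-tuple R) :
  size (monic_of a) = n.+1.
Proof. by rewrite size_polyDl size_polyXn// ltnS size_poly. Qed.

Lemma monic_of_monic (R : nzRingType) n (a : n.-tuple R) :
  monic_of a \is monic.
Proof.
by rewrite monicE lead_coefDl ?lead_coefXn// size_polyXn ltnS size_poly.
Qed.

Lemma coef_monic_of (R : nzRingType) n (a : n.-tuple R) (i : 'I_n) :
  (monic_of a)`_i = tnth a i.
Proof.
by rewrite coefD coefXn coef_poly ltn_ord ltn_eqF//= add0r (tnth_nth 0).
Qed.

Lemma monic_of_onto (R : nzRingType) n (f : {poly R}) :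
  f \is monic -> size f = n.+1 -> f = monic_of [tuple f`_i | i < n].
Proof.
move=> fm sf; apply/polyP => i; have [ni|ni|->] := ltngtP i n.
- by rewrite (coef_monic_of _ (Ordinal ni)) tnth_mktuple.
- by rewrite !nth_default ?size_monic_of// sf.
rewrite -[RHS](_ : lead_coef (monic_of [tuple f`_i | i < n]) = _).
  by rewrite (monicP (monic_of_monic _)) -(monicP fm) lead_coefE sf.
by rewrite lead_coefE size_monic_of.
Qed.

Definition relatively_prime (R : comNzRingType) (f g : {poly R}) : Prop :=
  ~ exists h : {poly R}, [/\ h \is monic, (1 < size h)%N,
      exists q, f = q * h & exists q, g = q * h].

Section PadicBorel.
Variable p : nat.

Let residueD (x y : padic p) k : (x + y) k = x k + y k. Proof. by []. Qed.
Let residueN (x : padic p) k : (- x) k = - x k. Proof. by []. Qed.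

Definition padic_cyl k (c : 'Z_(p ^ k.+1)) : set (padic p) :=
  [set x | x k = c].

Lemma residue_le (x y : padic p) j k : (j <= k)%N -> x k = y k -> x j = y j.
Proof.
elim: k => [|k IHk]; first by rewrite leqn0 => /eqP ->.
rewrite leq_eqVlt => /predU1P[->//|]; rewrite ltnS => jk xy.
by apply: IHk => //; rewrite -(residue_compat x) -(residue_compat y) xy.
Qed.

Lemma open_padic_cyl k (c : 'Z_(p ^ k.+1)) : open (padic_cyl c).
Proof.
exists (proj k @^-1` [set c]) => //.
pose K k : topologicalType := discrete_topology 'Z_(p ^ k.+1).
have cK := @proj_continuous nat K k.
apply: ((@continuousP (prod_topology K) (K k) (proj k)).1 cK [set c]).
exact: discrete_open.
Qed.

Lemma open_padicP (A : set (padic p)) x : open A -> A x ->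
  exists k, padic_cyl (x k) `<=` A.
Proof.
move=> [B oB <-] Bx.
pose F := filter_from [set: nat] (fun k => padic_cyl (x k)).
have FF : Filter F.
  apply: filter_from_filter; first by exists 0%N.
  move=> i j _ _; exists (maxn i j) => // y yx.
  by split; apply: residue_le yx; rewrite ?leq_maxl ?leq_maxr.
have : (@padic_incl p) @ F --> padic_incl x.
  apply/cvg_sup => i C.
  move=> -[D [[E oE <-] /= Ex DC]].
  exists i => // y yx; apply: DC.
  by rewrite /= /padic_incl yx.
have : nbhs (padic_incl x) B by apply: open_nbhs_nbhs; split.
move=> nB /(_ _ nB) [k _ kB].
by exists k.
Qed.

Definition padic_cyls : set (set (padic p)) :=
  [set A | A = set0 \/ exists k (c : 'Z_(p ^ k.+1)), A = padic_cyl c].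

Lemma padic_cyls_setI : setI_closed padic_cyls.
Proof.
move=> A B [->|[j [a ->]]]; first by rewrite set0I; left.
move=> [->|[k [b ->]]]; first by rewrite setI0; left.
have [[x [xa xb]]|noP] := pselect (exists x, padic_cyl a x /\ padic_cyl b x).
  right; wlog jk : j k a b xa xb / (j <= k)%N.
    by case/orP: (leq_total j k) => jk; [|rewrite setIC]; exact.
  exists k, b; apply/setIidr => y yb; rewrite /padic_cyl/=.
  by rewrite -xa; apply: residue_le jk _; rewrite xb yb.
by left; apply/seteqP; split=> // x /= xab; apply: noP; exists x.
Qed.

Lemma measurable_padic : @measurable _ (padic p) = <<s padic_cyls >>.
Proof.
apply/seteqP; split; apply: smallest_sub.
- exact: smallest_sigma_algebra.
- move=> A oA.
  rewrite (_ : A = \bigcup_k \bigcup_(c in [set c : 'Z_(p ^ k.+1) |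
    padic_cyl c `<=` A]) padic_cyl c); last first.
    apply/seteqP; split=> [x Ax|x [k _ [c /= cA xc]]]; last exact: cA.
    by have [k kA] := open_padicP oA Ax; exists k => //; exists (x k).
  apply: (@bigcupT_measurable _ (g_sigma_algebraType padic_cyls)) => k.
  apply: (@fin_bigcup_measurable _ (g_sigma_algebraType padic_cyls)).
    exact: finite_finset.
  by move=> c _; apply: sub_sigma_algebra; right; exists k, c.
- exact: smallest_sigma_algebra.
- move=> A [->|[k [c ->]]]; first exact: (@measurable0 _ (padic p)).
  by apply: sub_sigma_algebra; exact: open_padic_cyl.
Qed.

Lemma measurable_padic_cyl k (c : 'Z_(p ^ k.+1)) : measurable (padic_cyl c).
Proof. by apply: sub_sigma_algebra; exact: open_padic_cyl. Qed.

Lemma measurable_padicD (a : padic p) :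
  measurable_fun [set: padic p] (fun x => a + x).
Proof.
apply: (measurability padic_cyls measurable_padic) => _ [A + <-].
move=> [->|[k [c ->]]]; first by rewrite preimage_set0 setI0.
rewrite setTI (_ : _ @^-1` _ = padic_cyl (c - a k)).
  exact: measurable_padic_cyl.
apply/seteqP; split=> x; rewrite /padic_cyl /=.
  by move=> <-; rewrite ?residueD addrAC subrr add0r.
by move=> xc; rewrite ?residueD xc addrC subrK.
Qed.

Lemma is_padic_haar_cyl (R : realType) (mu : probability (padic p) R) :
  (forall k (c d : 'Z_(p ^ k.+1)), mu (padic_cyl c) = mu (padic_cyl d)) ->
  is_padic_haar mu.
Proof.
move=> mu_cyl a A mA.
pose f (x : padic p) := - a + x.
have imE B : [set a + x | x in B] = f @^-1` B.
  apply/seteqP; split=> [_ [x Bx <-]|x Bx]; first by rewrite /f /= addKr.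
  by exists (f x) => //; rewrite /f addrA subrr add0r.
rewrite imE.
have mf : measurable_fun setT f := measurable_padicD (- a).
pose f' : {mfun padic p >-> padic p} := mfun_Sub (mem_set mf).
pose g i := padic_cyl (inZp i : 'Z_(p ^ 1)).
apply: (@measure_unique _ R (padic p) padic_cyls g
  measurable_padic padic_cyls_setI _ _ (distribution mu f') mu) => //.
- by move=> i; right; exists 0%N, (inZp i).
- apply/seteqP; split=> // x _; exists (x 0%N) => //.
  by rewrite /g /padic_cyl /= valZpK.
- move=> B [->|[k [c ->]]]; first by rewrite !measure0.
  transitivity (mu (padic_cyl (a k + c))); last exact: mu_cyl.
  congr (mu _).
  apply/seteqP; split=> x; rewrite /padic_cyl /=.
    by move=> <-; rewrite /f ?residueD ?residueN addrA subrr add0r.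
  by move=> xc; rewrite /f ?residueD ?residueN xc addrA addNr add0r.
- move=> k; rewrite (le_lt_trans (probability_le1 _ _)) ?ltry//.
  exact: measurable_padic_cyl.
Qed.
End PadicBorel.

Section UnitInterval.
Variable R : realType.

Definition unit_itv_prob := mrestr (@lebesgue_measure R)
  (measurable_itv (`[0, 1[ : interval R)).

Fact unit_itv_prob1 : unit_itv_prob setT = 1%E.
Proof.
by rewrite /unit_itv_prob /mrestr setTI lebesgue_measure_itv /=
  lte01 oppr0 adde0.
Qed.

HB.instance Definition _ := Measure.on unit_itv_prob.
HB.instance Definition _ :=
  Measure_isProbability.Build _ _ _ unit_itv_prob unit_itv_prob1.

End UnitInterval.

Section PadicHaar.
Variables (R : realType) (p : nat).
Hypothesis p1 : (1 < p)%N.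

Let p0 : (0 < p)%N. Proof. exact: ltnW. Qed.
Let pk1 k : (1 < p ^ k.+1)%N.
Proof. by rewrite -(exp1n k.+1) ltn_exp2r. Qed.

Let N k (x : R) : nat := Num.truncn ((p ^ k)%:R * x).

Let NS k x : N k x = (N k.+1 x %/ p)%N.
Proof.
rewrite /N expnS natrM -mulrA; set y := _ * x.
have [y0|y0] := leP 0 y; last first.
  have py0 : p%:R * y < 0 by rewrite pmulr_rlt0 ?ltr0n.
  by rewrite !truncn_floor !leNgt y0 py0 div0n.
have py0 : 0 <= p%:R * y by rewrite mulr_ge0.
set n := Num.truncn (p%:R * y).
have /andP[ny yn] : n%:R <= p%:R * y < n.+1%:R by exact: truncn_itv.
have pR0 : 0 < p%:R :> R by rewrite ltr0n.
apply: truncn_def; apply/andP; split.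
  rewrite -(ler_pM2l pR0) -natrM; apply: le_trans ny.
  by rewrite ler_nat mulnC leq_divM.
rewrite -(ltr_pM2l pR0) -natrM; apply: lt_le_trans yn _.
by rewrite ler_nat mulnC ltn_ceil.
Qed.

Let s k x := (\sum_(i < k) (N i.+1 x %% p) * p ^ i)%N.

Let sS k x : s k.+1 x = (s k x + (N k.+1 x %% p) * p ^ k)%N.
Proof. by rewrite /s big_ord_recr. Qed.

Let s_lt k x : (s k x < p ^ k)%N.
Proof.
elim: k => [|k IHk]; first by rewrite /s big_ord0.
rewrite sS expnS (@leq_trans (p ^ k + (N k.+1 x %% p) * p ^ k)%N) ?ltn_add2r//.
by rewrite -mulSn leq_mul2r ltn_mod p0 orbT.
Qed.

Let s_eq k c : (c < p ^ k)%N -> exists2 a, (a < p ^ k)%N &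
  forall x, (s k x == c) = (N k x %% p ^ k == a)%N.
Proof.
elim: k c => [|k IHk] c.
  rewrite expn0 ltnS leqn0 => /eqP ->; exists 0%N => // x.
  by rewrite modn1 /s big_ord0.
move=> cp; have pk0 : (0 < p ^ k)%N by rewrite expn_gt0 p0.
have [a ap sa] := IHk (c %% p ^ k)%N (ltn_pmod _ pk0).
have dp : (c %/ p ^ k < p)%N by rewrite ltn_divLR// -expnS.
exists (a * p + c %/ p ^ k)%N => [|x].
  by rewrite expnSr (@leq_trans (a * p + p)%N) ?ltn_add2l//
    -mulSnr leq_mul2r ap orbT.
rewrite sS; set n := N k.+1 x.
transitivity ((s k x == c %% p ^ k) && (n %% p == c %/ p ^ k))%N.
  rewrite {1}(divn_eq c (p ^ k)) addnC.
  apply/eqP/andP => [E|[/eqP-> /eqP->//]].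
  have E1 := congr1 (fun u => u %% p ^ k)%N E.
  have E2 := congr1 (fun u => u %/ p ^ k)%N E.
  move: E1 E2; rewrite /= !modnMDl modn_mod !divnMDl// modn_small//.
  by rewrite divn_small// (divn_small (ltn_pmod _ pk0)) !addn0 => -> ->.
rewrite sa NS -/n; set M := (n %% p ^ k.+1)%N.
have -> : ((n %/ p) %% p ^ k = M %/ p)%N.
  by rewrite /M divn_modl ?expnSr ?dvdn_mull// mulnK.
have -> : (n %% p = M %% p)%N by rewrite /M modn_dvdm// expnSr dvdn_mull.
apply/andP/eqP => [[/eqP <- /eqP <-]|->]; first exact: divn_eq.
by rewrite divnMDl// modnMDl modn_small// divn_small// addn0.
Qed.

Fact padic_of_compat x k :
  padic_red (s k.+2 x)%:R = (s k.+1 x)%:R :> 'Z_(p ^ k.+1).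
Proof.
rewrite padic_red_nat sS natrD natrM pchar_Zp; last exact: pk1.
by rewrite mulr0 addr0.
Qed.

(* The p-adic integer whose digits are the base p digits of the fractional part
   of a nonnegative real number, the first digit becoming the lowest one. *)
Definition padic_of (x : R) : padic p := Padic (padic_of_compat x).

Let padic_of_cyl k (c : 'Z_(p ^ k.+1)) : exists2 a, (a < p ^ k.+1)%N &
  padic_of @^-1` padic_cyl c = [set x | (N k.+1 x %% p ^ k.+1)%N = a].
Proof.
have cp : (c < p ^ k.+1)%N by rewrite -[X in (_ < X)%N](Zp_cast (pk1 k)).
have [a ap sa] := s_eq cp; exists a => //.
apply/seteqP; split=> x /=.
  rewrite /padic_cyl /= => /(congr1 val) /=.
  rewrite val_Zp_nat ?pk1// modn_small// => /eqP.
  by rewrite sa => /eqP.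
move=> /eqP; rewrite -sa => /eqP sc.
by apply: val_inj; rewrite /= val_Zp_nat ?pk1// modn_small.
Qed.

Let measurable_N k n : measurable [set x : R | N k x = n].
Proof.
have q0 : 0 < (p ^ k)%:R :> R by rewrite ltr0n expn_gt0 p0.
have mG m : measurable [set x : R | (m < N k x)%N].
  rewrite (_ : [set x | _] = `[(m.+1)%:R / (p ^ k)%:R, +oo[%classic)//.
  apply/seteqP; split=> x /=;
    by rewrite /N truncn_gt_nat in_itv/= andbT ler_pdivrMr// mulrC.
have mGe m : measurable [set x : R | (m <= N k x)%N].
  by case: m => // ; rewrite (_ : [set x | _] = setT)//; apply/seteqP; split.
rewrite (_ : [set x | _] = [set x | (n <= N k x)%N] `\`
    [set x | (n < N k x)%N]).
  exact: measurableD.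
apply/seteqP; split=> x /= => [->|[le_nN /negP]]; first by rewrite ltnn leqnn.
by rewrite -leqNgt => Nn; apply/eqP; rewrite eqn_leq Nn.
Qed.

Let measurable_padic_of :
  measurable_fun [set: measurableTypeR R]
    (padic_of : measurableTypeR R -> padic p).
Proof.
apply: (measurability (@padic_cyls p) (@measurable_padic p)) => _ [A + <-].
rewrite setTI => -[->|[k [c ->]]]; first by rewrite preimage_set0.
have [a _ ->] := padic_of_cyl c.
rewrite (_ : [set x : R | _] = \bigcup_(n in [set n | (n %% p ^ k.+1)%N = a])
  [set x | N k.+1 x = n]).
  by apply: (@bigcup_measurable _ (measurableTypeR R)) => n _;
    exact: measurable_N.
by apply/seteqP; split=> x /= => [xa|[n <- <-//]]; exists (N k.+1 x).
Qed.

Lemma padic_haar_exists :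
  exists mu : probability (padic p) R, is_padic_haar mu.
Proof.
pose f : {mfun measurableTypeR R >-> padic p} :=
  @mfun_Sub _ _ (measurableTypeR R) (padic p) padic_of
    (mem_set measurable_padic_of).
exists (distribution (@unit_itv_prob R) f); apply: is_padic_haar_cyl => k.
suff mu_cyl (c : 'Z_(p ^ k.+1)) :
    distribution (@unit_itv_prob R) f (padic_cyl c) = ((p ^ k.+1)%:R^-1)%:E.
  by move=> c d; exact: etrans (mu_cyl c) (esym (mu_cyl d)).
rewrite /distribution /pushforward /= /unit_itv_prob /mrestr.
have [a ap ->] := padic_of_cyl c.
set q : R := (p ^ k.+1)%:R.
have q0 : 0 < q by rewrite ltr0n expn_gt0 p0.
rewrite (_ : _ `&` _ = `[a%:R / q, a.+1%:R / q[%classic); last first.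
  apply/seteqP; split=> x /=; rewrite !in_itv /=.
    move=> [Na /andP[x0 x1]].
    have qx0 : 0 <= q * x by rewrite mulr_ge0// ltW.
    have Nlt : (N k.+1 x < p ^ k.+1)%N.
      by rewrite /N truncn_lt_nat// -/q -[X in _ < X]mulr1 ltr_pM2l.
    rewrite ler_pdivrMr// ltr_pdivlMr// mulrC -Na modn_small//.
    exact: truncn_itv.
  rewrite ler_pdivrMr// ltr_pdivlMr// mulrC => /andP[ax xa].
  split.
    by rewrite /N -/q (truncn_def (n := a)) ?ax ?xa// modn_small.
  have qx0 : 0 <= q * x by apply: le_trans ax.
  rewrite -(pmulr_rge0 _ q0) qx0 /= -(ltr_pM2l q0) mulr1.
  by apply: lt_le_trans xa _; rewrite ler_nat.
rewrite lebesgue_measure_itv /= lte_fin ltr_pM2r ?invr_gt0// ltr_nat ltnSn.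
by rewrite -EFinB -mulrBl -natrB// subSnn mul1r.
Qed.

End PadicHaar.

(* Main.v *)
Require Import Defs.
From HB Require Import structures.
From mathcomp Require Import all_boot all_order all_algebra.
From mathcomp Require Import all_classical all_reals all_analysis.
From mathcomp Require Import ring.

Import Order.TTheory GRing.Theory Num.Theory.

Local Open Scope classical_set_scope.
Local Open Scope ring_scope.

(** Failure to be relatively prime is the vanishing of one polynomial in the
coefficients, the resultant, and the zero set of that polynomial is null
because it meets every line in one well-chosen direction in at most two
points.

Write g = X^2 + bX + c and let r0 + r1 X be the remainder of f modulo g.  The
resultant of f and g is the norm of this remainder in the free rank 2 algebra
Z_p[X]/(g), namely r0^2 - b r0 r1 + c r1^2.  It lies in the ideal (f, g), so
it is a multiple of any monic common divisor of positive degree and therefore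
zero as soon as there is one ([common_factor_quad_res]).  Conversely, if the
norm is zero and the remainder is not, then -r0/r1 is a root of g in the
fraction field; since g is monic and Z_p is a valuation ring, this root is
integral and X + r0/r1 is a common factor over Z_p itself
([quad_res_common_factor]).

A p-adic integer is zero when all its residues are, and the residue of the
resultant modulo p^k depends only on the residues of the coefficients.  Hence
the zero set of the resultant is a countable intersection of finite unions of
products of cylinders, and is measurable ([measurable_quad_res]).

Finally, when g and all the coefficients of f but the constant one a are
fixed, a enters the remainder only through r0, with coefficient 1, so the
resultant is a monic quadratic polynomial in a.  It has at most two roots in
the domain Z_p, and a translation invariant probability on the infinite group
Z_p has no atoms ([haar_singleton]).  Fubini's theorem concludes. *)

(** * The resultant with a monic quadratic polynomial *)

Section Resultant.
Context {R : comNzRingType}.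
Implicit Types (a b c : R) (s : seq R) (h : {poly R}).

(** Remainder of a monic polynomial modulo X^2 + bX + c, as the pair (constant
coefficient, linear coefficient), by Horner's scheme: multiplying r0 + r1 X by
X and replacing X^2 with - bX - c gives - c r1 + (r0 - b r1) X.  The argument
[s] lists the coefficients below the leading one, constant coefficient first,
whence the initial value 1.  This recursive form makes both the action of
ring morphisms and the dependence on the constant coefficient immediate. *)
Definition quad_rem b c s : R * R :=
  foldr (fun a r => (a - c * r.2, r.1 - b * r.2)) (1, 0) s.

(** The norm of r0 + r1 X from R[X]/(X^2 + bX + c) to R. *)
Definition quad_norm b c (r : R * R) : R :=
  r.1 ^+ 2 - b * r.1 * r.2 + c * r.2 ^+ 2.

(** The resultant of the monic polynomials with lower coefficients [s] and [g],
the latter being quadratic. *)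
Definition quad_res s (g : seq R) : R :=
  quad_norm g`_1 g`_0 (quad_rem g`_1 g`_0 s).

Lemma monic_of_cons n a (t : n.-tuple R) :
  monic_of [tuple of a :: t] = a%:P + 'X * monic_of t.
Proof.
apply/polyP => -[|i]; rewrite /monic_of.
  by rewrite !(coefD, coefXn, coef_poly, coefC, coefXM) eqxx add0r addr0.
rewrite !(coefD, coefXn, coef_poly, coefC, coefXM) /= add0r.
by rewrite eqSS ltnS; case: ifP.
Qed.

Lemma monic_of2 (g : 2.-tuple R) :
  monic_of g = 'X^2 + g`_1 *: 'X + (g`_0)%:P.
Proof.
rewrite /monic_of -addrA; congr (_ + _).
apply/polyP => -[|[|i]]; rewrite !(coefD, coefZ, coefX, coef_poly, coefC) /=.
- by rewrite mulr0 add0r.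
- by rewrite mulr1 addr0.
- by rewrite mulr0 addr0.
Qed.

Lemma quad_remP n (f : n.-tuple R) (g : 2.-tuple R) :
  let r := quad_rem g`_1 g`_0 f in
  exists q, monic_of f = q * monic_of g + (r.2 *: 'X + r.1%:P).
Proof.
rewrite monic_of2; elim: n f => [|n IHn] f.
  exists 0; rewrite tuple0 /= mul0r add0r scale0r add0r.
  rewrite /monic_of expr0 -[RHS]addr0; congr (_ + _).
  by apply/polyP => i; rewrite coef_poly coef0.
case/tupleP: f => a f; rewrite monic_of_cons /=.
have [q ->] := IHn f; set r := quad_rem _ _ _.
exists ('X * q + r.2%:P).
rewrite -!mul_polyC !(rmorphB, rmorphM) /=; ring.
Qed.

(** The cofactor of the remainder r0 + r1 X is its conjugate up to sign: the
conjugation of R[X]/(g) sends X to - b - X, hence r0 + r1 X to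
(r0 - b r1) - r1 X. *)
Lemma quad_norm_ideal (g : 2.-tuple R) (r : R * R) :
  (quad_norm g`_1 g`_0 r)%:P =
  (r.2 ^+ 2)%:P * monic_of g -
  (r.2 *: 'X + (g`_1 * r.2 - r.1)%:P) * (r.2 *: 'X + r.1%:P).
Proof.
rewrite /quad_norm monic_of2 -!mul_polyC.
rewrite !(rmorphD, rmorphN, rmorphB, rmorphM, rmorphXn) /=; ring.
Qed.

Lemma monic_dvd_polyC h q a :
  h \is monic -> (1 < size h)%N -> a%:P = q * h -> a = 0.
Proof.
move=> hm h1; have [->|q0] := eqVneq q 0.
  by rewrite mul0r => /eqP; rewrite polyC_eq0 => /eqP.
move=> /(congr1 (fun u : {poly R} => size u)).
rewrite size_Mmonic// size_polyC.
have : (0 < size q)%N by rewrite size_poly_gt0.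
case: (size q) (size h) h1 => [//|i] [|[|j]] // _ _.
by rewrite addSn !addnS /=; case: eqP.
Qed.

(** A monic h dividing f and g divides the remainder, hence by
[quad_norm_ideal] the constant polynomial equal to the resultant; degrees
leave no other possibility than zero. *)
Lemma common_factor_quad_res n (f : n.-tuple R) (g : 2.-tuple R) :
  ~ relatively_prime (monic_of f) (monic_of g) -> quad_res f g = 0.
Proof.
rewrite /relatively_prime => /contrapT [h [hm h1 [u fu] [v gv]]].
have [q] := quad_remP _ f g; set r := quad_rem _ _ _ => /= fq.
have rh : r.2 *: 'X + r.1%:P = (u - q * v) * h.
  by rewrite mulrBl -fu -mulrA -gv fq (addrC (q * _)) addrK.
apply: (@monic_dvd_polyC h ((r.2 ^+ 2)%:P * v -
  (r.2 *: 'X + (g`_1 * r.2 - r.1)%:P) * (u - q * v))) => //.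
by rewrite /quad_res quad_norm_ideal rh gv [RHS]mulrBl !mulrA.
Qed.

Hypothesis domR : GRing.integral_domain_axiom R.

Lemma sqr_eq0 a : a ^+ 2 = 0 -> a = 0.
Proof. by rewrite expr2 => /domR/orP[]/eqP. Qed.

(** The norm is a monic quadratic polynomial in r0, so over a domain it has at
most two zeros; the shift by [u] is the form in which the constant coefficient
of f enters [quad_rem]. *)
Lemma quad_norm_roots b c (u v : R) : exists x y : R,
  forall a, quad_norm b c (a - u, v) = 0 -> a = x \/ a = y.
Proof.
have [[x x0]|no] := pselect (exists x, quad_norm b c (x - u, v) = 0);
  last first.
  by exists 0, 0 => a a0; exfalso; apply: no; exists a.
(* The two roots a satisfy a - u + (x - u) = b v, by Vieta's formula. *)
exists x, (u + u + b * v - x) => a a0.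
have : (a - x) * (a - (u + u + b * v - x)) = 0.
  transitivity (quad_norm b c (a - u, v) - quad_norm b c (x - u, v)).
    rewrite /quad_norm /=; ring.
  by rewrite a0 x0 subrr.
by move/domR/orP => [] /eqP/subr0_eq; [left|right].
Qed.

Hypothesis valR : forall x y : R,
  (exists z, y = z * x) \/ (exists z, x = z * y).

(** This is integral closedness of a valuation ring, applied to the root
- r0/r1 of X^2 + bX + c: if instead r0 properly divided r1, say r1 = z r0,
then cancelling r0^2 from the norm would give 1 = z (b - c z), making z a unit
with inverse b - c z. *)
Lemma quad_norm_dvd b c (r : R * R) : quad_norm b c r = 0 ->
  r.2 != 0 -> exists z, r.1 = z * r.2.
Proof.
case: r => x y /= + y0; rewrite /quad_norm /= => n0.
have [[z yE]|//] := valR x y.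
have x0 : x != 0 by apply: contra_neq y0 => x0; rewrite yE x0 mulr0.
have : x ^+ 2 * (1 - z * (b - c * z)) = 0.
  by rewrite -[RHS]n0 yE; ring.
move=> /domR/orP[/eqP/sqr_eq0/eqP|/eqP/subr0_eq E].
  by rewrite (negPf x0).
exists (b - c * z); rewrite yE -[LHS]mul1r E; ring.
Qed.

(** If the remainder is zero, g itself is the common factor; otherwise r1 is not
zero, r1 divides r0, and the common factor is X + r0/r1. *)
Lemma quad_res_common_factor n (f : n.-tuple R) (g : 2.-tuple R) :
  quad_res f g = 0 -> ~ relatively_prime (monic_of f) (monic_of g).
Proof.
rewrite /quad_res; have [q /=] := quad_remP _ f g.
set r := quad_rem _ _ _ => fq n0; apply; have [r2|r2] := eqVneq r.2 0.
  have r1 : r.1 = 0.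
    by apply: sqr_eq0; rewrite -[RHS]n0 /quad_norm r2; ring.
  exists (monic_of g); rewrite monic_of_monic size_monic_of.
  split => //; last by exists 1; rewrite mul1r.
  by exists q; rewrite fq r1 r2 scale0r !addr0.
have [z r1] := quad_norm_dvd _ _ _ n0 r2.
have gz : g`_0 = z * (g`_1 - z).
  have : r.2 ^+ 2 * (z ^+ 2 - g`_1 * z + g`_0) = 0.
    by rewrite -[RHS]n0 /quad_norm r1; ring.
  case/domR/orP => [/eqP/sqr_eq0/eqP|/eqP E]; first by rewrite (negPf r2).
  by apply/subr0_eq; rewrite -[RHS]E; ring.
have gE : monic_of g = ('X + (g`_1 - z)%:P) * ('X + z%:P).
  rewrite monic_of2 gz -mul_polyC !(rmorphB, rmorphM) /=; ring.
exists ('X + z%:P); rewrite monicXaddC size_XaddC; split => //.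
  exists (q * ('X + (g`_1 - z)%:P) + r.2%:P).
  by rewrite fq gE r1 -mul_polyC rmorphM /=; ring.
by exists ('X + (g`_1 - z)%:P).
Qed.

End Resultant.

Lemma quad_res_map {R S : comNzRingType} (phi : {rmorphism R -> S})
    (s g : seq R) :
  quad_res (map phi s) (map phi g) = phi (quad_res s g).
Proof.
have nth_phi i : (map phi g)`_i = phi g`_i.
  have [ig|gi] := ltnP i (size g); first exact: nth_map.
  by rewrite !nth_default ?size_map ?rmorph0.
rewrite /quad_res !nth_phi; set b := g`_1; set c := g`_0.
suff -> : quad_rem (phi b) (phi c) (map phi s) =
    (phi (quad_rem b c s).1, phi (quad_rem b c s).2).
  by rewrite /quad_norm /= !(rmorphD, rmorphN, rmorphM, rmorphXn).
elim: s => [|a s IHs] /=; first by rewrite rmorph1 rmorph0.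
by rewrite IHs /= !(rmorphB, rmorphM).
Qed.

(** * The p-adic integers form a valuation ring *)

Section Residue.
Variables (p k : nat).
Let res (x : padic p) : 'Z_(p ^ k.+1) := x k.

Fact residue_is_zmod_morphism : zmod_morphism res.
Proof. by []. Qed.
Fact residue_is_monoid_morphism : monoid_morphism res.
Proof. by []. Qed.
HB.instance Definition _ := GRing.isZmodMorphism.Build _ _ res
  residue_is_zmod_morphism.
HB.instance Definition _ := GRing.isMonoidMorphism.Build _ _ res
  residue_is_monoid_morphism.

Lemma residue_nat n : (n%:R : padic p) k = n%:R.
Proof. exact: (rmorph_nat res). Qed.
End Residue.

Section PadicValuation.
Context {p : nat} (p_prime : prime p).
Implicit Types x y z : padic p.

Let pk_gt1 k : (1 < p ^ k.+1)%N.
Proof. by rewrite -(exp1n k.+1) ltn_exp2r// prime_gt1. Qed.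

Let Zp_natr_eq0 k n : (n%:R == 0 :> 'Z_(p ^ k.+1)) = (p ^ k.+1 %| n)%N.
Proof. by rewrite -(inj_eq val_inj) /= val_Zp_nat. Qed.

Lemma residueS_modn x k : (x k.+1 %% p ^ k.+1)%N = x k.
Proof.
transitivity (val (padic_red (x k.+1))); last by rewrite residue_compat.
by congr (_ %% _)%N; rewrite Zp_cast.
Qed.

Lemma residue0_modn x k : (x k %% p)%N = x 0%N.
Proof.
elim: k => [|k <-]; last first.
  by rewrite -(residueS_modn x k) modn_dvdm ?expnS ?dvdn_mulr.
rewrite modn_small//; have := ltn_ord (x 0%N).
by rewrite [X in (_ < X)%N]Zp_cast ?expn1// prime_gt1.
Qed.

(** The quotient by p shifts the index: its residue modulo p^(k+1) is 1/p times
the residue of x modulo p^(k+2). *)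
Lemma padic_dvd_p x : x 0%N = 0 -> exists y, x = p%:R * y.
Proof.
move=> x0; have p0 := prime_gt0 p_prime.
have pdvd k : (p %| x k)%N by rewrite /dvdn residue0_modn x0.
pose y k : 'Z_(p ^ k.+1) := (x k.+1 %/ p)%:R.
have cy k : padic_red (y k.+1) = y k.
  rewrite padic_red_nat; apply: val_inj; rewrite /= !val_Zp_nat//.
  rewrite -(residueS_modn x k.+1) (expnS p k.+1) divn_modl ?dvdn_mulr// mulKn//.
  by rewrite modn_mod.
exists (Padic cy); apply: padic_ext => k.
have -> : (p%:R * Padic cy) k = p%:R * y k by rewrite -residue_nat.
apply: val_inj; rewrite -natrM mulnC divnK// /= val_Zp_nat//.
by rewrite residueS_modn.
Qed.

(** Besides cancelling p, this is what makes the induction of [padic_factor]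
work: dividing by p moves the first nonzero residue one step down. *)
Lemma residue_mulp_eq0 y k : ((p%:R * y) k.+1 == 0) = (y k == 0).
Proof.
have -> : (p%:R * y) k.+1 = p%:R * y k.+1 by rewrite -residue_nat.
have pn n : (p%:R * n%:R == 0 :> 'Z_(p ^ k.+2)) = (p ^ k.+1 %| n)%N.
  by rewrite -natrM Zp_natr_eq0 expnS dvdn_pmul2l ?prime_gt0.
by rewrite -{1}(natr_Zp (y k.+1)) pn /dvdn residueS_modn.
Qed.

(** A residue prime to p is invertible modulo every power of p, and inverses are
compatible because they are unique. *)
Lemma padic_unit x : x 0%N != 0 -> exists y, y * x = 1.
Proof.
move=> x0; have u k : x k \is a GRing.unit.
  rewrite -(natr_Zp (x k)) unitZpE// coprimeXl// prime_coprime//.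
  apply: contra x0 => /eqP d; apply/eqP/val_inj.
  by rewrite -[LHS](residue0_modn x k) d.
have cy k : padic_red (x k.+1)^-1 = (x k)^-1.
  have red1 : padic_red (x k.+1)^-1 * x k = 1.
    by rewrite -(residue_compat x k) -padic_redM mulVr ?u.
  by rewrite -[LHS]mulr1 -(mulrV (u k)) mulrA red1 mul1r.
by exists (Padic cy); apply: padic_ext => k; exact: (mulVr (u k)).
Qed.

(** Every nonzero element is a power of p times a unit; both the absence of zero
divisors and the comparability of elements under divisibility follow. *)
Lemma padic_factor x : x != 0 ->
  exists n y, exists u, [/\ x = p%:R ^+ n * y & u * y = 1].
Proof.
move=> xn0; have [k] : exists k, x k != 0.
  apply: contrapT => no; move/eqP: xn0; apply; apply: padic_ext => k.
  by apply/eqP/negPn/negP => xk; apply: no; exists k.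
elim: k x {xn0} => [|k IHk] x xk.
  by have [u ux] := padic_unit _ xk; exists 0%N, x, u; rewrite expr0 mul1r.
have [/padic_dvd_p[y xE]|/eqP x0] := pselect (x 0%N = 0); last first.
  by have [u ux] := padic_unit _ x0; exists 0%N, x, u; rewrite expr0 mul1r.
have yk : y k != 0 by rewrite -residue_mulp_eq0 -xE.
have [n [z [u [yE uz]]]] := IHk y yk.
by exists n.+1, z, u; rewrite xE yE exprS mulrA.
Qed.

Lemma padic_domain : GRing.integral_domain_axiom (padic p).
Proof.
move=> x y xy; apply/norP => -[/padic_factor[n [y1 [u [xE uy]]]] y0].
move: xy; rewrite xE -mulrA => /(congr1 (fun w => u * w)).
rewrite mulr0 mulrCA (mulrA u) uy mul1r; elim: n {xE} => [|n IHn].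
  by rewrite expr0 mul1r; exact/eqP.
rewrite exprS -mulrA => E; apply: IHn; apply: padic_ext => k.
by apply/eqP; rewrite -residue_mulp_eq0 E.
Qed.

Lemma padic_dvd_total x y : (exists z, y = z * x) \/ (exists z, x = z * y).
Proof.
have [->|x0] := eqVneq x 0; first by right; exists 0; rewrite mul0r.
have [->|y0] := eqVneq y 0; first by left; exists 0; rewrite mul0r.
have [i [a [u [xE ua]]]] := padic_factor _ x0.
have [j [b [v [yE vb]]]] := padic_factor _ y0.
wlog ij : x y {x0 y0} i j a b u v xE ua yE vb / (i <= j)%N.
  move=> W; case/orP: (leq_total i j) => ij.
    by apply: (W x y i j a b u v).
  by apply/or_comm; apply: (W y x j i b a v u).
left; exists (p%:R ^+ (j - i) * (u * b)).
by rewrite yE xE mulrACA -exprD subnK// mulrAC ua mul1r.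
Qed.

End PadicValuation.

(** * The zero set of the resultant is measurable *)

Lemma measurable_tuple_residue {p} n k (c : n.-tuple 'Z_(p ^ k.+1)) :
  measurable [set t : n.-tuple (padic p) |
    map_tuple (fun x : padic p => x k) t = c].
Proof.
rewrite (_ : [set t | _] =
    [set t : n.-tuple (padic p) | forall i, padic_cyl (tnth c i) (tnth t i)]).
  apply: (measurable_box (A := fun i => padic_cyl (tnth c i))) => i.
  exact: measurable_padic_cyl.
apply/seteqP; split => t /= => [<- i|tc].
  by rewrite /padic_cyl /= tnth_map.
by apply: eq_from_tnth => i; rewrite tnth_map; exact: tc.
Qed.

(** Modulo p^(k+1) only finitely many tuples of residues occur, so vanishing of
the resultant modulo p^(k+1) is a finite union of products of cylinders. *)
Lemma measurable_quad_res p m : measurable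
  [set fg : m.-tuple (padic p) * 2.-tuple (padic p) | quad_res fg.1 fg.2 = 0].
Proof.
pose res k (x : padic p) := x k.
rewrite (_ : [set fg | _] = \bigcap_k \bigcup_(cd in
  [set cd : m.-tuple 'Z_(p ^ k.+1) * 2.-tuple 'Z_(p ^ k.+1) |
    quad_res cd.1 cd.2 = 0])
   ([set t : m.-tuple (padic p) | map_tuple (res k) t = cd.1] `*`
    [set t : 2.-tuple (padic p) | map_tuple (res k) t = cd.2])).
  apply: bigcapT_measurable => k; apply: fin_bigcup_measurable.
    exact: finite_finset.
  by move=> cd _; apply: measurableX; exact: measurable_tuple_residue.
apply/seteqP; split => [[f g] /= fg0 k _|[f g] /= fg].
  exists (map_tuple (res k) f, map_tuple (res k) g) => //=.
  by rewrite (quad_res_map (res k)) fg0.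
apply: padic_ext => k; have [[c d] /= cd0 [/= fc gd]] := fg k I.
transitivity (quad_res c d); last exact: cd0.
by rewrite -fc -gd; exact: (esym (quad_res_map (res k) f g)).
Qed.

Lemma measurable_padic1 {p} (a : padic p) : measurable [set a].
Proof.
rewrite (_ : [set a] = \bigcap_k padic_cyl (a k)).
  by apply: bigcapT_measurable => k; exact: measurable_padic_cyl.
apply/seteqP; split=> [x -> k _ //|x ax]; apply: padic_ext => k; exact: ax.
Qed.

(** * The zero set of the resultant is null *)

(** Tonelli's theorem for a null set, with the roles of the factors exchanged:
[_ \x _] integrates the measures of the sections at a fixed first
coordinate. *)
Lemma product_measure_ysection_null d1 d2 (T1 : measurableType d1)
    (T2 : measurableType d2) (R : realType)
    (m1 : {sigma_finite_measure set T1 -> \bar R})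
    (m2 : {sigma_finite_measure set T2 -> \bar R}) (X : set (T1 * T2)) :
  measurable X -> (forall y, m1 (ysection X y) = 0%E) -> (m1 \x m2)%E X = 0%E.
Proof.
move=> mX X0; rewrite (product_measure_unique (m' := (m1 \x^ m2)%E))//.
  by apply: integral0_eq => y _; exact: X0.
by move=> A B mA mB; exact: product_measure2E.
Qed.

Section Haar.
Context {R : realType} {p : nat} (p_prime : prime p).
Variables (mu : probability (padic p) R) (mu_haar : is_padic_haar mu).

Lemma padic_natr_inj : injective (fun n => n%:R : padic p).
Proof.
move=> i j /= /(congr1 (fun x : padic p => x (maxn i j) : nat)).
have big n : (n <= maxn i j)%N -> (n < p ^ (maxn i j).+1)%N.
  move=> nm; apply: leq_ltn_trans nm (ltn_trans (ltnSn _) _).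
  exact: ltn_expl (prime_gt1 p_prime).
have p1 : (1 < p ^ (maxn i j).+1)%N.
  by rewrite -(exp1n (maxn i j).+1) ltn_exp2r// prime_gt1.
by rewrite !residue_nat !val_Zp_nat// !modn_small// big ?leq_maxl ?leq_maxr.
Qed.

(** By invariance all points have the same mass e, and Z_p contains n distinct
points for every n, so that n e <= 1. *)
Lemma haar_singleton (a : padic p) : mu [set a] = 0%E.
Proof.
have mu_const b : mu [set b] = mu [set a].
  rewrite -(mu_haar (b - a) _ (measurable_padic1 a)); congr (mu _).
  by rewrite image_set1 subrK.
have fin : mu [set a] \is a fin_num.
  by apply: fin_num_measure; exact: measurable_padic1.
rewrite -(fineK fin); congr EFin; set e := fine _.
have e0 : 0 <= e by apply: fine_ge0.
apply/eqP; rewrite eq_le e0 andbT leNgt; apply/negP => e_gt0.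
pose n := (Num.truncn (e^-1)).+1.
have mn i : measurable [set (i%:R : padic p)] by exact: measurable_padic1.
have : (mu (\big[setU/set0]_(i < n) [set (i%:R : padic p)]) <= 1)%E.
  by apply: probability_le1; exact: bigsetU_measurable.
rewrite measure_bigsetU_ord//; last first.
  by move=> i j _ _ [x [/= -> /padic_natr_inj/val_inj]].
rewrite (eq_bigr (fun=> e%:E)) => [|i _]; last first.
  by rewrite /e fineK//; exact: mu_const.
rewrite sumEFin sumr_const card_ord lee_fin -mulr_natl leNgt.
by rewrite -ltr_pdivrMr// div1r truncnS_gt.
Qed.

(** Fubini in the constant coefficient, which is the head of the tuple: for
fixed other coefficients the exceptional set is contained in a set of two
points. *)
Lemma tuple_prob_quad_res_null m (g : 2.-tuple (padic p)) : (0 < m)%N ->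
  tuple_prob mu m [set f | quad_res f g = 0] = 0%E.
Proof.
case: m => // m _ /=; rewrite /distribution /pushforward.
have mS : measurable [set f : m.+1.-tuple (padic p) | quad_res f g = 0].
  have := measurable_ysection g (measurable_quad_res p m.+1).
  by congr measurable; apply/seteqP; split => f; rewrite ysectionP.
have mC : measurable (@tuple_cons _ _ m @^-1` [set f | quad_res f g = 0]).
  by rewrite -[X in measurable X]setTI; exact: measurable_tuple_cons.
apply: product_measure_ysection_null => //.
move=> t; set r := quad_rem g`_1 g`_0 t.
have [x [y xy]] := quad_norm_roots (padic_domain p_prime)
  g`_1 g`_0 (g`_0 * r.2) (r.1 - g`_1 * r.2).
apply: (@subset_measure0 _ _ _ mu _ ([set x] `|` [set y])).
- exact: measurable_ysection.
- by apply: measurableU; exact: measurable_padic1.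
- by move=> a /ysectionP /= /xy.
- rewrite -(haar_singleton x); apply: measureU0; last exact: haar_singleton.
    exact: measurable_padic1.
  exact: measurable_padic1.
Qed.
End Haar.

Theorem theorem5 (R : realType) (p m : nat) (p_prime : prime p) (p_odd : odd p)
    (m_ge1 : (1 <= m)%N)
    (mu : probability (padic p) R) (mu_haar : is_padic_haar mu) :
  let coprime_pairs :=
    [set fg : m.-tuple (padic p) * 2.-tuple (padic p) |
      relatively_prime (monic_of fg.1) (monic_of fg.2)] in
  measurable coprime_pairs /\
  (tuple_prob mu m \x tuple_prob mu 2)%E coprime_pairs = 1%E.
Proof.
pose N := [set fg : m.-tuple (padic p) * 2.-tuple (padic p) |
  quad_res fg.1 fg.2 = 0].
have mN : measurable N := measurable_quad_res p m.
move=> coprime_pairs; have -> : coprime_pairs = ~` N.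
  apply/seteqP; split => -[f g] /=.
    move=> fg fg0; apply: quad_res_common_factor fg0 fg.
      exact: padic_domain.
    exact: padic_dvd_total.
  by move=> N0; apply: contrapT => /common_factor_quad_res.
split; first exact: measurableC.
have N0 : (tuple_prob mu m \x tuple_prob mu 2)%E N = 0%E.
  apply: product_measure_ysection_null => // g.
  rewrite -(tuple_prob_quad_res_null p_prime _ mu_haar _ g m_ge1).
  by congr (tuple_prob _ _ _); apply/seteqP; split => f; rewrite ysectionP.
by rewrite probability_setC// [X in (1 - X)%E]N0 sube0.
Qed.
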